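(* In the setting described in the context: (a) There is a primitive $e$-th root of unity $\zeta_e\in\mathbb{F}_q$ such that, for every $z\in\mathbb{Z}$, the restriction $\sigma|_{V_z}$ has minimal polynomial $X^f-\zeta_e^z$. In particular $V_{z+e}\cong V_z$ as $\mathbb{F}_q[H]$-modules for all $z\in\mathbb{Z}$. (b) For every $z\in\mathbb{Z}$ we have $V_z\oplus V_{z+1}\oplus\cdots\oplus V_{z+e-1}\cong(\mathbb{F}_p[H])^{[\mathbb{F}_q:\mathbb{F}_p]}$ as $\mathbb{F}_p[H]$-modules.
   Context: Let $p$ be a prime, $q$ a power of $p$, $F=\mathbb{F}_q((t))$. Let $L/F$ be a cyclic extension of degree $d=ef$ with $p\nmid d$, ramification index $e$ and inertia degree $f$. Write $L=\mathbb{F}_{q^f}((\pi_L))$ with uniformizer $\pi_L$ satisfying $\pi_L^e=\omega^{s}t$, where $\omega$ generates $\mathbb{F}_{q^f}^\times$ and $s$ is an integer. Let $H=\mathrm{Gal}(L/F)$ and let $\sigma$ be a generator of $H$ such that $\sigma(c)=c^q$ for all $c\in\mathbb{F}_{q^f}$ and $\sigma(\pi_L)\in\mathbb{F}_{q^f}^\times\pi_L$. For $z\in\mathbb{Z}$ let $V_z=\mathbb{F}_{q^f}\cdot\pi_L^z\subseteq L$; it is $\sigma$-invariant, hence an $\mathbb{F}_q[H]$-module (and $\mathbb{F}_p[H]$-module). *)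

(* Defs.v *)
From HB Require Import structures.
From mathcomp Require Import all_boot all_order all_algebra all_fingroup.
From mathcomp Require Import all_solvable all_field.
From mathcomp Require Import boolp classical_sets functions fsbigop.
From mathcomp Require Import zify.

Set Implicit Arguments.
Unset Strict Implicit.
Unset Printing Implicit Defensive.

Import Order.TTheory GRing.Theory Num.Theory.
Local Open Scope classical_set_scope.
Local Open Scope ring_scope.

Section Laurent.
Variable K : fieldType.

Definition supported_above (N : int) (a : int -> K) : Prop :=
  forall n, n < N -> a n = 0.

(* The field K((X)) of formal Laurent series: a : int -> K stands for
   \sum_n a n * X ^ n. *)
Record laurent := Laurent {
  lcoef :> int -> K;
  lcoef_supp : exists N, supported_above N lcoef }.

Lemma laurentP (x y : laurent) : lcoef x =1 lcoef y <-> x = y.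
Proof.
split=> [|-> //]; case: x y => [a Ha] [b Hb] /= /funext eab.
by rewrite -eab in Hb *; congr Laurent; apply: Prop_irrelevance.
Qed.

HB.instance Definition _ := gen_eqMixin laurent.
HB.instance Definition _ := gen_choiceMixin laurent.

Fact lzero_supp : exists N, supported_above N (fun=> 0). Proof. by exists 0. Qed.
Definition lzero := Laurent lzero_supp.

Fact lopp_supp (x : laurent) : exists N, supported_above N (fun n => - x n).
Proof. by have [N xN] := lcoef_supp x; exists N => n /xN ->; rewrite oppr0. Qed.
Definition lopp x := Laurent (lopp_supp x).

Fact ladd_supp (x y : laurent) : exists N, supported_above N (fun n => x n + y n).
Proof.
have [M xM] := lcoef_supp x; have [N yN] := lcoef_supp y.
by exists (Num.min M N) => n; rewrite lt_min => /andP[/xM -> /yN ->]; rewrite addr0.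
Qed.
Definition ladd x y := Laurent (ladd_supp x y).

Fact laddA : associative ladd.
Proof. by move=> x y z; apply/laurentP => n /=; rewrite addrA. Qed.
Fact laddC : commutative ladd.
Proof. by move=> x y; apply/laurentP => n /=; rewrite addrC. Qed.
Fact ladd0 : left_id lzero ladd.
Proof. by move=> x; apply/laurentP => n /=; rewrite add0r. Qed.
Fact laddN : left_inverse lzero lopp ladd.
Proof. by move=> x; apply/laurentP => n /=; rewrite addNr. Qed.
HB.instance Definition _ := GRing.isZmodule.Build laurent laddA laddC ladd0 laddN.

(* Only finitely many terms of the sum are nonzero. *)
Definition conv (a b : int -> K) (n : int) : K :=
  \sum_(i \in [set: int]) a i * b (n - i).

Lemma conv_supp M N a b :
  supported_above M a -> supported_above N b -> supported_above (M + N) (conv a b).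
Proof.
move=> aM bN n ltn; apply: fsbig1 => i _.
have [/aM ->|leM] := ltP i M; first by rewrite mul0r.
by rewrite bN ?mulr0 //; lia.
Qed.

Lemma convE M N a b n (m : nat) :
    supported_above M a -> supported_above N b -> n < M + N + m%:Z ->
  conv a b n = \sum_(i < m) a (M + i%:Z) * b (n - (M + i%:Z)).
Proof.
move=> aM bN ltn; pose h (i : nat) : int := M + i%:Z.
have hinj : injective h by move=> i j; rewrite /h; lia.
rewrite /conv (fsbig_ord _ m (fun i => a (h i) * b (n - h i))).
rewrite -(fsbig_image (`I_m) h (fun i => a i * b (n - i))); last first.
  by move=> i j _ _ /hinj.
apply/esym/fsbig_widen => // i [_ /= notI].
have [/aM ->|leM] := ltP i M; first by rewrite mul0r.
rewrite bN ?mulr0 //; apply/negP => /negP; rewrite -leNgt => le; apply: notI.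
by exists `|i - M|%N; rewrite /= /h; lia.
Qed.

Fact lmul_supp (x y : laurent) : exists N, supported_above N (conv x y).
Proof.
have [M xM] := lcoef_supp x; have [N yN] := lcoef_supp y.
by exists (M + N); apply: conv_supp.
Qed.
Definition lmul x y := Laurent (lmul_supp x y).

Fact lconst_supp (c : K) : exists N, supported_above N (fun n => c *+ (n == 0)).
Proof. by exists 0 => n; case: eqP => // ->. Qed.
Definition lconst c := Laurent (lconst_supp c).

Fact lmulC : commutative lmul.
Proof.
move=> x y; apply/laurentP => n /=; rewrite /conv.
have bij : bijective (fun i : int => n - i).
  by exists (fun i : int => n - i) => i; rewrite subKr.
rewrite (reindex_fsbigT _ (fun i => x i * y (n - i)) bij).
by apply: eq_fsbigr => i _; rewrite subKr mulrC.
Qed.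

Fact lmulCA (x y z : laurent) : lmul x (lmul y z) = lmul y (lmul x z).
Proof.
apply/laurentP => n /=.
have [A xA] := lcoef_supp x; have [B yB] := lcoef_supp y.
have [C zC] := lcoef_supp z.
have [m ltm] : exists m : nat, n < A + B + C + m%:Z.
  by exists (absz (n - (A + B + C))%R).+1; lia.
have yzE (i : 'I_m) : conv y z (n - (A + i%:Z)) =
    \sum_(j < m) y (B + j%:Z) * z (n - (A + i%:Z) - (B + j%:Z)).
  by apply: (convE yB zC); lia.
have xzE (i : 'I_m) : conv x z (n - (B + i%:Z)) =
    \sum_(j < m) x (A + j%:Z) * z (n - (B + i%:Z) - (A + j%:Z)).
  by apply: (convE xA zC); lia.
have ltx : n < A + (B + C) + m%:Z by lia.
have lty : n < B + (A + C) + m%:Z by lia.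
rewrite (convE xA (conv_supp yB zC) ltx) (convE yB (conv_supp xA zC) lty).
under eq_bigr do rewrite yzE mulr_sumr.
under [RHS]eq_bigr do rewrite xzE mulr_sumr.
rewrite exchange_big; apply: eq_bigr => j _; apply: eq_bigr => i _.
by rewrite mulrCA; do 2!congr (_ * _); congr (lcoef z _); lia.
Qed.

Fact lmulA : associative lmul.
Proof. by move=> x y z; rewrite (lmulC y z) lmulCA lmulC. Qed.

Lemma lmul_constE c x n : lmul (lconst c) x n = c * x n.
Proof.
have [N xN] := lcoef_supp x; rewrite /lmul /=.
have c0 : supported_above 0 (lconst c) by move=> m /=; case: eqP => // ->.
have ltn : n < 0 + N + `|n - N|.+1%:Z by lia.
rewrite (convE c0 xN ltn) big_ord_recl big1 ?addr0 /= => [|i _]; last by rewrite mul0r.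
by congr (_ * lcoef x _); lia.
Qed.

Fact lmul1 : left_id (lconst 1) lmul.
Proof. by move=> x; apply/laurentP => n; rewrite lmul_constE mul1r. Qed.

Fact lmulDl : left_distributive lmul ladd.
Proof.
move=> x y z; apply/laurentP => n /=.
have [A' xA'] := lcoef_supp x; have [B' yB'] := lcoef_supp y.
pose A := Num.min A' B'.
have xA : supported_above A x by move=> i; rewrite lt_min => /andP[/xA'].
have yA : supported_above A y by move=> i; rewrite lt_min => /andP[_ /yB'].
have xyA : supported_above A (ladd x y).
  by move=> i /[dup] /xA /= -> /yA ->; rewrite addr0.
have [C zC] := lcoef_supp z.
have ltm : n < A + C + (absz (n - (A + C))%R).+1%:Z by lia.
rewrite (convE xA zC ltm) (convE yA zC ltm) (convE xyA zC ltm) -big_split.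
by apply: eq_bigr => i _; rewrite /= mulrDl.
Qed.

Fact lone_neq0 : lconst 1 != 0.
Proof.
apply/eqP => /(congr1 (fun x : laurent => x 0)) /= /eqP.
by rewrite oner_eq0.
Qed.

HB.instance Definition _ :=
  GRing.Zmodule_isComNzRing.Build laurent lmulA lmulC lmul1 lmulDl lone_neq0.

(* has_val x n: the normalized valuation of x is n. *)
Definition has_val (x : laurent) (n : int) : Prop :=
  x n != 0 /\ supported_above n x.

Lemma has_val_ex (x : laurent) : x != 0 -> exists n, has_val x n.
Proof.
move=> x0; have [N xN] := lcoef_supp x.
have exn : exists i : nat, x (N + i%:Z) != 0.
  apply: contrapT => nx; move/eqP: x0; apply; apply/laurentP => n /=.
  have [/xN //|le] := ltP n N; apply/eqP/negPn/negP => xn; apply: nx.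
  by exists `|n - N|%N; rewrite (_ : _ + _ = n) //; lia.
have xn := ex_minnP exn; case: xn => m xm min; exists (N + m%:Z); split=> // n ltn.
have [/xN //|le] := ltP n N; apply/eqP/negPn/negP => xn.
have := min `|n - N|%N; rewrite (_ : N + _ = n); last lia.
by move=> /(_ xn); lia.
Qed.

Section Inverse.
Variable a : nat -> K.
(* the first n.+1 coefficients of the inverse of \sum_i a i * X ^ i, reversed *)
Fixpoint inv_coefs (n : nat) : seq K :=
  if n is m.+1 then
    let s := inv_coefs m in
    - (a 0)^-1 * (\sum_(i < n) a i.+1 * nth 0 s i) :: s
  else [:: (a 0)^-1].
Definition inv_coef n := head 0 (inv_coefs n).

Lemma nth_inv_coefs n i : (i <= n)%N -> nth 0 (inv_coefs n) i = inv_coef (n - i).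
Proof.
elim: n i => [|n IH] [|i] //=.
by rewrite ltnS => /IH ->; rewrite subSS.
Qed.

Lemma inv_coefP n : a 0 != 0 ->
  \sum_(i < n.+1) a i * inv_coef (n - i) = (n == 0)%:R.
Proof.
move=> a0; rewrite big_ord_recl /= subn0; case: n => [|n].
  by rewrite big_ord0 addr0 /inv_coef /= mulfV.
rewrite {1}/inv_coef /= mulrA mulrN mulfV // mulN1r addrC; apply/eqP.
rewrite subr_eq0; apply/eqP; apply: eq_bigr => i _.
by rewrite nth_inv_coefs ?subSS // -ltnS.
Qed.
End Inverse.

Lemma laurent_inv_ex (x : laurent) : x != 0 -> exists y : laurent, y * x = 1.
Proof.
move=> /has_val_ex[N [xN0 xN]].
pose a i := x (N + i%:Z); have a0 : a 0%N != 0 by rewrite /a addr0.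
pose b (n : int) := if 0 <= n + N then inv_coef a (absz (n + N)%R) else 0.
have bN : supported_above (- N) b by move=> n ltn; rewrite /b ifF //; lia.
have bs : exists M, supported_above M b by exists (- N).
exists (Laurent bs); rewrite mulrC; apply/laurentP => n /=.
have [n_lt0|n_ge0] := ltP n 0.
  rewrite (conv_supp xN bN); last lia.
  by case: eqP => // n0; move: n_lt0; rewrite n0.
rewrite (@convE N (- N) _ _ _ `|n|.+1) //; try lia.
transitivity (\sum_(i < `|n|.+1) a i * inv_coef a (`|n| - i)%N).
  apply: eq_bigr => i _; congr (_ * _); rewrite /b ifT; last first.
    by have := ltn_ord i; lia.
  by congr inv_coef; have := ltn_ord i; lia.
rewrite inv_coefP //; congr (_ *+ _); lia.
Qed.

Definition linv (x : laurent) : laurent :=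
  if pselect (exists y : laurent, y * x = 1) is left e then projT1 (cid e) else 0.

Fact lmulVx (x : laurent) : x != 0 -> linv x * x = 1.
Proof.
by move=> /laurent_inv_ex ex; rewrite /linv; case: pselect => // e; case: cid.
Qed.
Fact linv0 : linv 0 = 0.
Proof.
rewrite /linv; case: pselect => // e; exfalso; case: e => y.
by rewrite mulr0 => /esym/eqP; rewrite oner_eq0.
Qed.

HB.instance Definition _ := GRing.ComNzRing_isField.Build laurent lmulVx linv0.

Fact lconst_is_zmod : zmod_morphism lconst.
Proof. by move=> c d; apply/laurentP => n /=; rewrite mulrnBl. Qed.
Fact lconst_is_monoid : monoid_morphism lconst.
Proof.
split=> // c d; apply/laurentP => n; rewrite [RHS]lmul_constE /=.
by rewrite mulrnAr.
Qed.
HB.instance Definition _ := GRing.isZmodMorphism.Build K laurent lconst lconst_is_zmod.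
HB.instance Definition _ := GRing.isMonoidMorphism.Build K laurent lconst lconst_is_monoid.

Fact lX_supp : exists N, supported_above N (fun n => (n == 1)%:R).
Proof. by exists 1 => n; case: eqP => // ->. Qed.
Definition lX := Laurent lX_supp.

End Laurent.

Section GroupAlgebra.
Variables (R : comNzRingType) (gT : finGroupType).

(* a : gT -> R stands for \sum_g a g * g *)
Definition group_algebra : predArgType := {ffun gT -> R}.

HB.instance Definition _ := GRing.Zmodule.on group_algebra.

Implicit Types a b c : group_algebra.

Definition ga_one : group_algebra := [ffun g => (g == 1%g)%:R].
Definition ga_mul a b : group_algebra :=
  [ffun g => \sum_h a h * b (h^-1 * g)%g].

Fact ga_mulA : associative ga_mul.
Proof.
move=> a b c; apply/ffunP => g; rewrite !ffunE.
under eq_bigr do rewrite ffunE mulr_sumr.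
under [RHS]eq_bigr do rewrite ffunE mulr_suml.
rewrite [RHS]exchange_big /=; apply: eq_bigr => h _.
rewrite [RHS](reindex_inj (mulgI h)) /=; apply: eq_bigr => u _.
by rewrite mulKg mulrA invMg mulgA.
Qed.
Fact ga_mul1 : left_id ga_one ga_mul.
Proof.
move=> a; apply/ffunP => g; rewrite ffunE (bigD1 1%g) //= big1 => [|h /negPf h1].
  by rewrite ffunE eqxx mul1r invg1 mul1g addr0.
by rewrite ffunE h1 mul0r.
Qed.
Fact ga_mulr1 : right_id ga_one ga_mul.
Proof.
move=> a; apply/ffunP => g; rewrite ffunE (bigD1 g) //= big1 => [|h hg].
  by rewrite ffunE mulVg eqxx mulr1 addr0.
by rewrite ffunE -eq_mulVg1 (negPf hg) mulr0.
Qed.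
Fact ga_mulDl : left_distributive ga_mul +%R.
Proof.
move=> a b c; apply/ffunP => g; rewrite !ffunE -big_split.
by apply: eq_bigr => h _; rewrite ffunE mulrDl.
Qed.
Fact ga_mulDr : right_distributive ga_mul +%R.
Proof.
move=> a b c; apply/ffunP => g; rewrite !ffunE -big_split.
by apply: eq_bigr => h _; rewrite ffunE mulrDr.
Qed.
Fact ga_one_neq0 : ga_one != 0.
Proof. by apply/eqP => /ffunP/(_ 1%g)/eqP; rewrite !ffunE eqxx oner_eq0. Qed.

HB.instance Definition _ := GRing.Zmodule_isNzRing.Build group_algebra
  ga_mulA ga_mul1 ga_mulr1 ga_mulDl ga_mulDr ga_one_neq0.
End GroupAlgebra.

Section GaloisModule.
Variables (F : fieldType) (L : splittingFieldType F).

(* Gal(L / F). The group law of gal_of is (x * y) a = y (x a); here it is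
   composition, (x * y) a = x (y a), so that L is a left module. *)
Definition gal_group : predArgType := gal_of {:L}.

HB.instance Definition _ := Finite.on gal_group.

Definition gg_mul (x y : gal_group) : gal_group :=
  ((y : gal_of {:L}) * (x : gal_of {:L}))%g.
Definition gg_one : gal_group := (1 : gal_of {:L})%g.
Definition gg_inv (x : gal_group) : gal_group := ((x : gal_of {:L})^-1)%g.

Fact gg_mulA : associative gg_mul.
Proof. by move=> x y z; rewrite /gg_mul mulgA. Qed.
Fact gg_mul1 : left_id gg_one gg_mul.
Proof. by move=> x; apply: mulg1. Qed.
Fact gg_mulV : left_inverse gg_one gg_inv gg_mul.
Proof. by move=> x; apply: mulgV. Qed.
HB.instance Definition _ :=
  Finite_isGroup.Build gal_group gg_mulA gg_mul1 gg_mulV.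

Definition gg_app (g : gal_group) (x : L) : L := (g : gal_of {:L}) x.

Lemma gg_app1 x : gg_app 1%g x = x. Proof. exact: gal_id. Qed.
Lemma gg_appM g h x : gg_app (g * h)%g x = gg_app g (gg_app h x).
Proof. by rewrite /gg_app [(g * h)%g]/(gg_mul g h) galM ?memvf. Qed.

(* L as a module over k[Gal(L / F)], for a field k embedded in F. *)
Definition gal_module (k : fieldType) (iota : {rmorphism k -> F}) :
  predArgType := L.

Variables (k : fieldType) (iota : {rmorphism k -> F}).
Local Notation M := (gal_module iota).

HB.instance Definition _ := GRing.Zmodule.on M.

Definition gm_scale (a : group_algebra k gal_group) (x : M) : M :=
  \sum_(g : gal_group) iota (a g) *: gg_app g x.

Fact gm_scaleA a b x : gm_scale a (gm_scale b x) = gm_scale (a * b) x.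
Proof.
rewrite /gm_scale.
under eq_bigr do rewrite /gg_app linear_sum scaler_sumr.
under [RHS]eq_bigr do rewrite ffunE rmorph_sum scaler_suml.
rewrite [RHS]exchange_big /=; apply: eq_bigr => g _.
rewrite [RHS](reindex_inj (mulgI g)) /=; apply: eq_bigr => h _.
by rewrite mulKg linearZ rmorphM -scalerA -!/(gg_app _ _) gg_appM.
Qed.
Fact gm_scale1 : left_id 1 gm_scale.
Proof.
move=> x; rewrite /gm_scale (bigD1 1%g) //= big1 => [|g /negPf g1].
  by rewrite ffunE eqxx rmorph1 scale1r gg_app1 addr0.
by rewrite ffunE g1 rmorph0 scale0r.
Qed.
Fact gm_scaleDr : right_distributive gm_scale +%R.
Proof.
move=> a x y; rewrite /gm_scale -big_split; apply: eq_bigr => g _.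
by rewrite /gg_app linearD scalerDr.
Qed.
Fact gm_scaleDl x : {morph gm_scale^~ x : a b / a + b}.
Proof.
move=> a b; rewrite /gm_scale -big_split; apply: eq_bigr => g _.
by rewrite ffunE rmorphD scalerDl.
Qed.
HB.instance Definition _ :=
  GRing.Zmodule_isLmodule.Build (group_algebra k gal_group) M
    gm_scaleA gm_scale1 gm_scaleDr gm_scaleDl.
End GaloisModule.

Section Submodules.
Variable R : nzRingType.

Definition is_submodule (M : lmodType R) (U : set M) : Prop :=
  U 0 /\ forall (a : R) (x y : M), U x -> U y -> U (a *: x + y).

Definition submodule_isom (M N : lmodType R) (U : set M) (W : set N) : Prop :=
  [/\ is_submodule U, is_submodule W &
      exists phi : M -> N, set_bij U W phi /\
        forall (a : R) (x y : M), U x -> U y ->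
          phi (a *: x + y) = a *: phi x + phi y].

(* the external direct sum of the U i *)
Definition dsum (M : lmodType R) n (U : 'I_n -> set M) : set {ffun 'I_n -> M} :=
  [set x | forall i, U i (x i)].
End Submodules.

Section MinimalPolynomial.
Variables (k F : fieldType) (iota : {rmorphism k -> F}) (V : lmodType F).

Definition poly_apply (P : {poly k}) (T : V -> V) (x : V) : V :=
  \sum_(i < size P) iota P`_i *: iter i T x.

(* P is the minimal polynomial over k of the restriction of T to U. *)
Definition is_minpoly_on (U : set V) (T : V -> V) (P : {poly k}) : Prop :=
  P \is monic /\
  forall Q : {poly k}, (forall x, U x -> poly_apply Q T x = 0) <-> P %| Q.
End MinimalPolynomial.

Section PrimeField.
Variables (p : nat) (k : fieldType) (pchark : p \in [pchar k]).

Definition Fp_incl (a : 'F_p) : k := in_alg (pPrimeCharType pchark) a.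

Fact Fp_incl_is_zmod : zmod_morphism Fp_incl.
Proof. exact: (raddfB (in_alg (pPrimeCharType pchark))). Qed.
Fact Fp_incl_is_monoid : monoid_morphism Fp_incl.
Proof.
by split; [apply: (rmorph1 (in_alg (pPrimeCharType pchark)))
          |apply: (rmorphM (in_alg (pPrimeCharType pchark)))].
Qed.
HB.instance Definition _ := GRing.isZmodMorphism.Build 'F_p k Fp_incl Fp_incl_is_zmod.
HB.instance Definition _ :=
  GRing.isMonoidMorphism.Build 'F_p k Fp_incl Fp_incl_is_monoid.
End PrimeField.

Section LocalExtension.
Variables (k K : fieldType) (L : splittingFieldType (laurent k)).
(* An identification L = K((pi)), with uniformizer pi = Phi X and residue
   field K. *)
Variable Phi : {rmorphism laurent K -> L}.

Definition has_valL (x : L) (n : int) : Prop :=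
  exists2 y, Phi y = x & has_val y n.

(* v_L restricts to e * v_F on F = k((t)). *)
Definition is_ramification_index (e : nat) : Prop :=
  forall (x : laurent k) n, has_val x n -> has_valL x%:A (e%:Z * n).

Definition Vspace (z : int) : set L :=
  [set x | exists c : K, x = Phi (lconst c) * Phi (lX K) ^ z].
End LocalExtension.

(* Main.v *)
(** Write sigma(pi) = u pi and let N(u) be the norm of u from K to k.  On
    V_z = K pi^z the power sigma^f is multiplication by N(u)^z, so zeta = N(u)
    works provided it has order exactly e.  Since t is a constant times pi^e,
    every element of L is a finite F-combination of the c pi^i with c in K and
    i < e; hence a power of sigma fixing K and pi is trivial, which gives the
    order of zeta.  On coefficients, Q(sigma) acts on V_z as a q-linearized
    polynomial of degree less than #|K| when deg Q < f, so X^f - zeta^z is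
    minimal.  As p does not divide d, these polynomials are separable and each
    V_z has a cyclic vector; since the e polynomials for consecutive z are
    pairwise coprime of total degree d, the family of these vectors generates a
    free k[H]-module of rank one, which is everything by counting. *)
Require Import Defs.
From mathcomp Require Import all_boot all_order all_algebra all_fingroup.
From mathcomp Require Import all_solvable all_field.
From mathcomp Require Import boolp classical_sets functions zify.
Set Implicit Arguments.
Unset Strict Implicit.
Unset Printing Implicit Defensive.
Import Order.TTheory GRing.Theory Num.Theory.
Local Open Scope ring_scope.

(** * Roots of X^#|K| - X in extensions of a finite field *)

Lemma expf_card_image (K : finFieldType) (E : fieldType)
    (h : {rmorphism K -> E}) (y : E) :
  y ^+ #|K| = y -> exists c, y = h c.
Proof.
(* Over K, X^#|K| - X is the product of all X - c; mapped to E and evaluated at [y], this product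
   vanishes. *)
move=> yE; have := congr1 (fun P => (map_poly h P).[y]) (finField_genPoly K).
rewrite rmorphB /= map_polyXn map_polyX rmorph_prod horner_prod !hornerE yE subrr.
move/esym/eqP/prodf_eq0 => [c _].
by rewrite /= map_polyXsubC !hornerE subr_eq0 => /eqP ->; exists c.
Qed.

(** A fixed point of the q-th power map is fixed by its f-fold iterate, the #|K|-th power. *)
Lemma expfM_card_image (K : finFieldType) (E : fieldType)
    (h : {rmorphism K -> E}) (q f : nat) (y : E) :
  #|K| = (q ^ f)%N -> y ^+ q = y -> exists c, y = h c.
Proof.
move=> cardK yq; apply: expf_card_image; rewrite cardK.
by elim: f {cardK} => // f IH; rewrite expnS exprM yq.
Qed.

(** * Polynomials in a linear operator, annihilators of vectors and cyclic vectors *)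

Section PolyApply.
Variables (k F : fieldType) (iota : {rmorphism k -> F}) (V : lmodType F).
Variable T : {linear V -> V}.
Implicit Types P Q : {poly k}.
Local Notation "P $ x" := (poly_apply iota P T x) (at level 40).

Lemma poly_apply_widen n P x : (size P <= n)%N ->
  P $ x = \sum_(i < n) iota P`_i *: iter i T x.
Proof.
move=> le; rewrite /poly_apply (big_ord_widen n (fun i => iota P`_i *: iter i T x)) //.
rewrite [LHS]big_mkcond; apply: eq_bigr => i _ /=.
by case: ltnP => // /(nth_default 0) ->; rewrite rmorph0 scale0r.
Qed.

Lemma poly_applyD P Q x : (P + Q) $ x = P $ x + Q $ x.
Proof.
pose n := maxn (size P) (size Q).
rewrite !(@poly_apply_widen n) ?leq_maxl ?leq_maxr ?(leq_trans (size_polyD _ _)) //.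
by rewrite -big_split; apply: eq_bigr => i _; rewrite coefD rmorphD scalerDl.
Qed.

Lemma poly_applyDr P x y : P $ (x + y) = P $ x + P $ y.
Proof.
rewrite /poly_apply -big_split; apply: eq_bigr => i _ /=; rewrite -scalerDr.
by congr (_ *: _); elim: (nat_of_ord i) => //= n ->; rewrite linearD.
Qed.

Lemma poly_apply0 x : 0 $ x = 0.
Proof. by rewrite /poly_apply size_poly0 big_ord0. Qed.

Lemma poly_apply0r P : P $ 0 = 0.
Proof.
have /eqP := poly_applyDr P 0 0.
by rewrite addr0 addrC -subr_eq subrr => /eqP.
Qed.

Lemma poly_applyC c x : c%:P $ x = iota c *: x.
Proof. by rewrite (@poly_apply_widen 1) ?size_polyC_leq1 // big_ord1 coefC. Qed.

Lemma poly_applyMX P x : (P * 'X) $ x = T (P $ x).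
Proof.
rewrite (@poly_apply_widen (size P).+1); last first.
  by rewrite (leq_trans (size_polyMleq _ _)) ?size_polyX ?addn2.
rewrite big_ord_recl coefMX rmorph0 scale0r add0r linear_sum.
by apply: eq_bigr => i _; rewrite linearZ coefMX.
Qed.

Lemma poly_applyZ c P x : (c *: P) $ x = iota c *: (P $ x).
Proof.
rewrite !(@poly_apply_widen (size P)) ?size_scale_leq // scaler_sumr.
by apply: eq_bigr => i _; rewrite coefZ rmorphM scalerA.
Qed.

Lemma poly_applyM P Q x : (P * Q) $ x = P $ (Q $ x).
Proof.
elim/poly_ind: P => [|P c IH]; first by rewrite mul0r !poly_apply0.
rewrite mulrDl !poly_applyD mulrAC !poly_applyMX IH; congr (_ + _).
by rewrite mul_polyC poly_applyZ poly_applyC.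
Qed.

Lemma poly_applyXn n x : 'X^n $ x = iter n T x.
Proof.
elim: n => [|n IH]; first by rewrite poly_applyC rmorph1 scale1r.
by rewrite exprSr poly_applyMX IH.
Qed.

Lemma poly_apply_dvd P Q x : P %| Q -> P $ x = 0 -> Q $ x = 0.
Proof. by move=> /divpK <- Px; rewrite poly_applyM Px poly_apply0r. Qed.

(** A generator of the ideal of polynomials killing [x], unique up to a nonzero scalar. *)
Definition is_annihilator x P := forall Q, Q $ x = 0 <-> P %| Q.

(** Descent on the size: if [P] does not divide some [Q] killing [x], then [Q %% P] is nonzero,
    smaller than [P], and still kills [x]. *)
Lemma is_annihilator_ex P x :
  P != 0 -> P $ x = 0 -> exists R, is_annihilator x R.
Proof.
have [n] := ubnP (size P); elim: n P => // n IH P /ltnSE le P0 Px.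
have [PQ|] := pselect (forall Q, Q $ x = 0 -> P %| Q).
  by exists P => Q; split=> [/PQ //|/poly_apply_dvd]; apply.
move=> /existsNP[Q /not_implyP[Qx /negP nPQ]]; apply: (IH (Q %% P)) => //.
  by apply: leq_trans le; rewrite ltn_modp.
apply: (@addrI _ (Q %/ P * P $ x)).
by rewrite -poly_applyD -divp_eq Qx poly_applyM Px poly_apply0r addr0.
Qed.

(** If [R] kills [x + y], then [Q * R] kills [x] because [Q] kills [y]; so [P] divides [Q * R],
    hence [R] by coprimality. The roles are then exchanged. *)
Lemma is_annihilatorD x y P Q : is_annihilator x P -> is_annihilator y Q ->
  coprimep P Q -> is_annihilator (x + y) (P * Q).
Proof.
move=> annx anny cPQ R.
have Px : P $ x = 0 by apply/annx.
have Qy : Q $ y = 0 by apply/anny.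
rewrite Gauss_dvdp // poly_applyDr; split=> [Rxy|/andP[]]; last first.
  by move=> /annx -> /anny ->; rewrite addr0.
apply/andP; split.
  rewrite -(Gauss_dvdpr _ cPQ); apply/annx; rewrite poly_applyM.
  move: Rxy => /(congr1 (poly_apply iota Q T)).
  by rewrite poly_applyDr poly_apply0r -[X in _ + X]poly_applyM mulrC poly_applyM
    Qy poly_apply0r addr0.
rewrite coprimep_sym in cPQ.
rewrite -(Gauss_dvdpr _ cPQ); apply/anny; rewrite poly_applyM.
move: Rxy => /(congr1 (poly_apply iota P T)).
by rewrite poly_applyDr poly_apply0r -[X in X + _]poly_applyM mulrC poly_applyM
  Px poly_apply0r add0r.
Qed.

(* If x has annihilator P, a proper divisor of m, then m / P is coprime to P
   and P does not kill some v; adding P v to x enlarges the annihilator. *)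
Lemma cyclic_vector (U : set V) m :
    U 0 -> (forall x y, U x -> U y -> U (x + y)) ->
    (forall P x, U x -> U (P $ x)) ->
    separable_poly m -> is_minpoly_on iota U T m ->
  exists2 x, U x & is_annihilator x m.
Proof.
move=> U0 UD UP sep_m [/monic_neq0 m0 minm].
(* Induction on the deficit of [P] with respect to [m], starting from the zero vector, whose
   annihilator is 1. *)
suff H n x P : (size m - size P < n)%N -> U x -> is_annihilator x P ->
    exists2 x, U x & is_annihilator x m.
  apply: (H _ 0 1 (ltnSn _) U0) => Q; rewrite dvd1p poly_apply0r; split=> //.
elim: n x P => // n IH x P lt_n Ux annx.
have Pm : P %| m by apply/annx/(minm m).2.
have P0 : P != 0 by apply: contraNneq m0 => P0; rewrite P0 dvd0p in Pm.
have [mP|/negP nmP] := boolP (m %| P).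
  have /eqp_dvdl eqPm : P %= m by apply/andP.
  by exists x => // Q; rewrite annx eqPm.
have /existsNP[v /not_implyP[Uv /eqP Pv]] : ~ forall v, U v -> P $ v = 0.
  by move=> /minm.
have mE := divpK Pm; set Q := m %/ P in mE.
have [//||R annPv] := @is_annihilator_ex Q (P $ v).
- by apply: contraNneq m0; rewrite -mE => ->; rewrite mul0r.
- by rewrite -poly_applyM mE; apply/(minm m).2.
have RQ : R %| Q by apply/annPv; rewrite -poly_applyM mE; apply/(minm m).2.
have cPR : coprimep P R.
  move: sep_m; rewrite -mE separable_mul => /and3P[_ _]; rewrite coprimep_sym.
  exact: coprimep_dvdl.
apply: (IH (x + P $ v) (P * R)); [|exact/UD/UP|exact: is_annihilatorD].
have R0 : R != 0.
  apply: contraNneq m0 => R0; rewrite R0 dvd0p in RQ.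
  by rewrite -mE (eqP RQ) mul0r.
(* [R] is not constant because it kills the nonzero vector [P $ v]; so [P * R] is strictly larger
   than [P]. *)
have R1 : size R != 1%N.
  apply: contraNneq Pv => /eqP sR; rewrite -[_ $ v]scale1r -(rmorph1 iota).
  rewrite -poly_applyC; apply/eqP/annPv.
  by rewrite (eqp_dvdl _ (_ : R %= 1)) ?dvd1p // -size_poly_eq1.
have PRm : P * R %| m by rewrite -mE mulrC dvdp_mul.
have := dvdp_leq m0 PRm; rewrite !size_mul //.
have : (0 < size R)%N by rewrite size_poly_gt0.
by move: lt_n R1; move: (size m) (size P) (size R) => a b c; lia.
Qed.
End PolyApply.

(** * Coprime polynomials, and inverses of module isomorphisms *)

Lemma dvdp_prod_coprime (k : fieldType) (I : finType) (P : I -> {poly k}) Q :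
    (forall i j, i != j -> coprimep (P i) (P j)) ->
  (forall i, P i %| Q) -> \prod_i P i %| Q.
Proof.
move=> cP PQ; have := index_enum_uniq I; elim: (index_enum I) => [|i s IH] /=.
  by rewrite big_nil dvd1p.
move=> /andP[i_s /IH sQ]; rewrite big_cons Gauss_dvdp ?PQ //.
rewrite big_seq; elim/big_rec: _ => [|j R js cR]; first exact: coprimep1.
by rewrite coprimepMr cR cP //; apply: contraNneq i_s => ->.
Qed.

(** The two polynomials differ by the nonzero constant [b - a], which yields the Bezout
    coefficients. *)
Lemma coprimep_subC (k : fieldType) (P : {poly k}) (a b : k) :
  a != b -> coprimep (P - a%:P) (P - b%:P).
Proof.
move=> ab; apply/Bezout_eq1_coprimepP; exists ((b - a)^-1%:P, - (b - a)^-1%:P) => /=.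
rewrite mulNr -mulrBr (_ : _ - _ = (b - a)%:P) -?polyCM ?mulVf //; last first.
  by rewrite polyCB opprB addrCA addrAC subrr add0r addrC.
by rewrite subr_eq0 eq_sym.
Qed.

(** Lets an isomorphism be built in the convenient direction, from [W] to [U]. The inverse is chosen
    pointwise, with value 0 outside [U]. *)
Lemma submodule_isom_inv (R : nzRingType) (M N : lmodType R) (U : set M)
    (W : set N) (psi : N -> M) :
    is_submodule U -> is_submodule W ->
    (forall a x y, psi (a *: x + y) = a *: psi x + psi y) ->
    set_bij W U psi -> submodule_isom U W.
Proof.
move=> subU subW psiL [psiW psiI psiS]; split=> //.
have inv u : exists w, U u -> W w /\ psi w = u.
  by have [/psiS[w]|nU] := pselect (U u); [exists w|exists 0].
have [phi phiP] := choice inv.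
have phiW u (Uu : U u) : W (phi u) := (phiP u Uu).1.
have phiK u (Uu : U u) : psi (phi u) = u := (phiP u Uu).2.
exists phi; split; first split=> //.
- by move=> u v /[!inE] Uu Uv /(congr1 psi); rewrite !phiK.
- move=> w Ww; exists (psi w); first exact: psiW.
  by apply: psiI; rewrite ?inE; [exact/phiW/psiW| |exact/phiK/psiW].
move=> a x y Ux Uy; apply: psiI; rewrite ?inE.
- by apply/phiW/subU.2.
- by apply: subW.2; apply: phiW.
by rewrite psiL !phiK //; apply: subU.2.
Qed.

(** * Coefficients of products with constants and powers of X *)

Section LaurentFacts.
Variable K : fieldType.
Implicit Types x y : laurent K.

Lemma lcoefB x y n : (x - y) n = x n - y n. Proof. by []. Qed.
Lemma lcoef_sum I (r : seq I) (P : pred I) (G : I -> laurent K) n :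
  (\sum_(i <- r | P i) G i) n = \sum_(i <- r | P i) G i n.
Proof. by apply: (big_morph (fun x : laurent K => x n)). Qed.
Lemma lcoef_const (c : K) n : lconst c n = c *+ (n == 0). Proof. by []. Qed.
Lemma lcoefCM c x n : (lconst c * x) n = c * x n. Proof. exact: lmul_constE. Qed.

Lemma lconst_inj : injective (@lconst K).
Proof. exact: fmorph_inj. Qed.

Lemma lX_neq0 : lX K != 0.
Proof.
by apply/eqP => /(congr1 (fun x : laurent K => x 1)) /eqP; rewrite /= oner_eq0.
Qed.

Lemma lcoefXM x n : (lX K * x) n = x (n - 1).
Proof.
have [N xN] := lcoef_supp x.
have X1 : supported_above 1 (lX K) by move=> m /=; case: eqP => // ->.
have ltn : n < 1 + N + (absz (n - 1 - N)%R).+1%:Z by lia.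
rewrite [LHS](convE X1 xN ltn) big_ord_recl big1 ?addr0 ?mul1r // => i _.
by rewrite /= /bump mul0r.
Qed.

Lemma lcoefXzM (z : int) x n : (lX K ^ z * x) n = x (n - z).
Proof.
have nat_case (m : nat) y i : (lX K ^+ m * y) i = y (i - m%:Z).
  elim: m y i => [|m IH] y i; first by rewrite mul1r subr0.
  by rewrite exprSr -mulrA IH lcoefXM; congr (lcoef y _); lia.
case: z => m; first exact: nat_case.
(* For a negative exponent, multiplying back by the opposite power of X reduces to the natural
   case. *)
have := nat_case m.+1 (lX K ^ Negz m * x) (n + m.+1%:Z).
rewrite mulrA NegzE -exprnN mulfV ?expf_neq0 ?lX_neq0 // mul1r addrK => <-.
by congr (lcoef x _); lia.
Qed.

Lemma lcoefXz (z : int) n : (lX K ^ z) n = (n == z)%:R.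
Proof.
by rewrite -[_ ^ _]mulr1 lcoefXzM lcoef_const subr_eq0.
Qed.

End LaurentFacts.

Lemma gm_scaleE (F : fieldType) (L : splittingFieldType F) (k : fieldType)
    (iota : {rmorphism k -> F}) a (x : gal_module L iota) :
  a *: x = \sum_(g : gal_group L) iota (a g) *: gg_app g x :> L.
Proof. by []. Qed.

(** Links the embedding of F_p to the F_p-vector space structure of k, from which a basis is taken
    later. *)
Lemma Fp_inclM (p : nat) (k : finFieldType) (pchark : p \in [pchar k])
    (a : 'F_p) (v : pPrimeCharType pchark) :
  Fp_incl pchark a * (v : k) = a *: v.
Proof.
have <- : (a *: 1) * v = a *: v by rewrite -scalerAl mul1r.
by [].
Qed.

(** * Constants, uniformizer and coefficients of k((t)) inside L = K((pi)) *)

Section LocalGalois.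
Variables (q e f : nat) (k K : finFieldType).
Variables (L : splittingFieldType (laurent k)) (Phi : {rmorphism laurent K -> L}).
Variables (omega : {unit K}) (s : int).
Hypotheses (e_gt0 : (0 < e)%N) (f_gt0 : (0 < f)%N).
Hypotheses (card_k : #|k| = q) (card_K : #|K| = (q ^ f)%N).
Hypotheses (Phi_bij : bijective Phi) (ram_e : is_ramification_index Phi e).
Hypothesis pi_e :
  Phi (lX K) ^+ e = Phi (lconst (val omega)) ^ s * (lX k)%:A.

Local Notation w := (val omega).
Local Notation pi := (Phi (lX K)).
Local Notation PhiC c := (Phi (lconst c)).

Fact pi_neq0 : pi != 0. Proof. by rewrite fmorph_eq0 lX_neq0. Qed.
Fact w_neq0 : w != 0. Proof. by have := valP omega; rewrite unitfE. Qed.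
Fact PhiC_inj : injective (fun c => PhiC c).
Proof. by move=> c d /fmorph_inj/lconst_inj. Qed.

(** The image of [a] in L is fixed by the q-th power map, hence is a constant from K. *)
Lemma base_const_ex (a : k) : exists c, PhiC c = (lconst a)%:A.
Proof.
have aq : (lconst a)%:A ^+ q = (lconst a)%:A :> L.
  by rewrite -in_algE -!rmorphXn /= -card_k expf_card.
by have [c ->] := expfM_card_image (Phi \o @lconst K) card_K aq; exists c.
Qed.

(** The embedding of residue fields k -> K induced by L/F. *)
Definition base_const (a : k) : K := projT1 (cid (base_const_ex a)).

Lemma base_constE a : Phi (lconst (base_const a)) = (lconst a)%:A.
Proof. by rewrite /base_const; case: cid. Qed.

Lemma base_const_inj : injective base_const.
Proof.
move=> a b /(congr1 (fun c => PhiC c)); rewrite !base_constE -!in_algE.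
by move=> /fmorph_inj/lconst_inj.
Qed.

Lemma base_const0 : base_const 0 = 0.
Proof. by apply: PhiC_inj; rewrite base_constE !rmorph0 scale0r. Qed.

Lemma base_const1 : base_const 1 = 1.
Proof. by apply: PhiC_inj; rewrite base_constE !rmorph1 scale1r. Qed.

Lemma base_unif : (lX k)%:A = Phi (lconst (w ^ - s) * lX K ^+ e).
Proof.
rewrite rmorphM rmorphXn /= pi_e mulrA -!fmorphXz /= -!rmorphM /= -expfzDr ?w_neq0 //.
by rewrite addNr expr0z !rmorph1 mul1r.
Qed.

Lemma base_unifX (N : int) :
  (lX k ^ N)%:A = Phi (lconst (w ^ (- s * N)) * lX K ^ (e%:Z * N)).
Proof.
rewrite -[LHS]in_algE fmorphXz /= base_unif -fmorphXz /= expfzMl.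
by rewrite -fmorphXz /= exprnP !exprz_exp.
Qed.

Lemma base_supp N (x : laurent k) (y : laurent K) :
  Phi y = x%:A -> supported_above N x -> supported_above (e%:Z * N) y.
Proof.
move=> yx xN n ltn; have [x0|/has_val_ex[v xv]] := eqVneq x 0.
  move: yx; rewrite x0 scale0r => /eqP; rewrite fmorph_eq0 => /eqP -> //.
have [y' /esym] := ram_e xv; rewrite -yx => /fmorph_inj -> [_ supp].
apply: supp; apply: lt_le_trans ltn _; rewrite ler_pM2l; last by rewrite ltz_nat.
by rewrite leNgt; apply: contraTN (xv.1) => /xN ->; rewrite eqxx.
Qed.

(* This holds for monomials x, and since Phi scales valuations by e the tail of
   x does not contribute to a given coefficient of y. *)
Lemma base_coef (x : laurent k) (y : laurent K) (m : int) (i : nat) :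
    Phi y = x%:A -> (i < e)%N ->
  y (e%:Z * m + i%:Z) = (base_const (x m) * w ^ (- s * m)) *+ (i == 0%N).
Proof.
move=> yx lti; have [N xN] := lcoef_supp x.
have [M ltM] : exists M : nat, m < N + M%:Z by exists (absz (m - N)%R).+1; lia.
elim: M N x y yx xN ltM => [|M IH] N x y yx xN ltM.
  rewrite addr0 in ltM; rewrite xN // base_const0 mul0r mul0rn.
  by apply: (base_supp yx xN); nia.
(* Removing the lowest term of [x], and its counterpart in [y], raises [N] by one; [M] bounds the
   distance left to [m]. *)
pose x1 := lconst (x N) * lX k ^ N.
pose y1 := lconst (base_const (x N) * w ^ (- s * N)) * lX K ^ (e%:Z * N).
have yx1 : Phi y1 = x1%:A.
  rewrite /y1 [lconst _]rmorphM -mulrA rmorphM base_constE -base_unifX.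
  by rewrite -[RHS]in_algE rmorphM.
have yx2 : Phi (y - y1) = (x - x1)%:A by rewrite scalerBl rmorphB yx yx1.
have x1E n : x1 n = x N *+ (n == N) by rewrite lcoefCM lcoefXz mulr_natr.
have xN2 : supported_above (N + 1) (x - x1).
  move=> n ltn; rewrite lcoefB x1E; case: eqP => [->|neq]; first by rewrite subrr.
  by rewrite subr0 xN //; lia.
have ltM2 : m < N + 1 + M%:Z by lia.
have /eqP := IH _ _ _ yx2 xN2 ltM2.
rewrite !lcoefB x1E lcoefCM lcoefXz subr_eq => /eqP ->.
have [->|neq] := eqVneq m N.
  rewrite subrr base_const0 mul0r mul0rn add0r mulr_natr; congr (_ *+ nat_of_bool _).
  by apply/eqP/idP => [|/eqP ->]; lia.
rewrite subr0 (_ : (e%:Z * m + _ == _) = false) ?mulr0 ?addr0 //; apply/eqP => eqN.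
have /orP[lt|lt] : (m + 1 <= N) || (N + 1 <= m) by lia.
  by have := ler_wpM2l (ler0n _ e) lt; rewrite mulrDr; lia.
by have := ler_wpM2l (ler0n _ e) lt; rewrite mulrDr; lia.
Qed.

(** As t^m is w^(-sm) pi^(em), the term of [y] of degree em + i is c pi^i t^m with c its coefficient
    times w^(sm). The series [a i c] is the indicator of the m giving this c, so no k-basis of K is
    needed. *)
Lemma base_span (y : L) : exists a : 'I_e -> K -> laurent k,
  y = \sum_(i < e) \sum_c PhiC c * pi ^+ i * (a i c)%:A.
Proof.
have [Psi PsiK PhiK] := Phi_bij; pose y0 := Psi y.
have [N y0N] := lcoef_supp y0.
pose a (i : 'I_e) (c : K) (m : int) : k :=
  ((c != 0) && (y0 (e%:Z * m + i%:Z) * w ^ (s * m) == c))%:R.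
(* The condition [c != 0] keeps the support bounded below, since the coefficients of [y0] vanish far
   to the left. *)
have a_supp i c : exists M, supported_above M (a i c).
  exists (- `|N| - 1) => m ltm; rewrite /a y0N ?mul0r; last first.
    by have := ltn_ord i; nia.
  by rewrite eq_sym; case: eqP.
exists (fun i c => Laurent (a_supp i c)).
suff y0E : y0 = \sum_(i < e) \sum_c
    lconst c * (lX K ^+ i * Psi (Laurent (a_supp i c))%:A).
  rewrite -[LHS]PhiK -/y0 y0E rmorph_sum; apply: eq_bigr => i _.
  rewrite rmorph_sum; apply: eq_bigr => c _.
  by rewrite !rmorphM rmorphXn /= PhiK mulrA.
apply/laurentP => n; rewrite lcoef_sum.
under eq_bigr => i _ do rewrite lcoef_sum.
have e0 : e%:Z != 0 by lia.
have [m [i0 ->]] : exists m, exists i0 : 'I_e, n = e%:Z * m + i0%:Z.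
  have lt_mod : (absz (n %% e)%Z < e)%N.
    have := ltz_pmod n (e_gt0 : 0 < e%:Z); have := modz_ge0 n e0.
    by move: (n %% e)%Z => r0; lia.
  exists (n %/ e)%Z, (Ordinal lt_mod) => /=.
  rewrite {1}(divz_eq n e) mulrC gez0_abs //; exact: modz_ge0.
have PsiE i c m1 j : (j < e)%N -> Psi (Laurent (a_supp i c))%:A (e%:Z * m1 + j%:Z) =
    (base_const (a i c m1) * w ^ (- s * m1)) *+ (j == 0%N).
  by move=> ltj; rewrite (base_coef _ (PhiK _)).
(* Terms with i different from [i0] vanish: i0 - i is not a multiple of e. If i0 < i, the remainder
   is e + i0 - i and the quotient m - 1. *)
rewrite (bigD1 i0) // [X in _ = _ + X]big1 ?addr0 => [|i /andP[_ neq]]; last first.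
  apply: big1 => c _; rewrite lcoefCM exprnP lcoefXzM.
  have [lti|gei] := ltnP i0 i.
    rewrite (_ : _ - _ = e%:Z * (m - 1) + (e + i0 - i)%N%:Z); last first.
      by have := ltn_ord i; lia.
    have [ltj nj] : (e + i0 - i < e)%N /\ (e + i0 - i == 0)%N = false.
      by have := ltn_ord i; lia.
    by rewrite PsiE // nj mulr0n mulr0.
  rewrite (_ : _ - _ = e%:Z * m + (i0 - i)%N%:Z); last by lia.
  have ne : (i0 : nat) != i by rewrite eq_sym.
  have [ltj nj] : (i0 - i < e)%N /\ (i0 - i == 0)%N = false.
    by have := ltn_ord i0; lia.
  by rewrite PsiE // nj mulr0n mulr0.
have termE c : (lconst c * (lX K ^+ i0 * Psi (Laurent (a_supp i0 c))%:A))
    (e%:Z * m + i0%:Z) = c * (base_const (a i0 c m) * w ^ (- s * m)).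
  by rewrite lcoefCM exprnP lcoefXzM addrK -[e%:Z * m]addr0 PsiE.
under eq_bigr do rewrite termE.
have [y0_0|y0_n0] := eqVneq (y0 (e%:Z * m + i0%:Z)) 0.
  rewrite y0_0 big1 // => c _; rewrite /a y0_0 mul0r eq_sym andNb base_const0.
  by rewrite mul0r mulr0.
rewrite (bigD1 (y0 (e%:Z * m + i0%:Z) * w ^ (s * m))) //= big1 ?addr0 => [|c neq].
  rewrite /a eqxx mulf_neq0 ?expfz_neq0 ?w_neq0 //= base_const1 mul1r -mulrA.
  by rewrite -expfzDr ?w_neq0 // mulNr subrr mulr1.
by rewrite /a [_ == c]eq_sym (negPf neq) andbF base_const0 mul0r mulr0.
Qed.

(** The products c pi^i are fixed by [g], span L over F by [base_span], and [g] is F-linear. *)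
Lemma gal_eq1 (g : gal_of {:L}) :
  (forall c, g (PhiC c) = PhiC c) -> g pi = pi -> g = 1%g.
Proof.
move=> gC gpi; apply/eqP/gal_eqP => y _; rewrite gal_id.
have [a ->] := base_span y; rewrite rmorph_sum; apply: eq_bigr => i _.
rewrite rmorph_sum; apply: eq_bigr => c _.
by rewrite !rmorphM rmorphXn /= gC gpi linearZ /= rmorph1.
Qed.

(** * The action of sigma on monomials, and the root of unity zeta *)

Variables (sigma : gal_of {:L}) (u : K).
Hypotheses (u_neq0 : u != 0) (sigma_pi : sigma pi = PhiC u * pi).
Hypothesis sigma_const : forall c, sigma (PhiC c) = PhiC c ^+ q.

Definition Vmonom (z : int) (c : K) : L := Phi (lconst c) * pi ^ z.

Lemma Vmonom0 z : Vmonom z 0 = 0.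
Proof. by rewrite /Vmonom !rmorph0 mul0r. Qed.

Lemma VmonomD z c1 c2 : Vmonom z (c1 + c2) = Vmonom z c1 + Vmonom z c2.
Proof. by rewrite /Vmonom !rmorphD mulrDl. Qed.

Lemma Vmonom_sum z I (r : seq I) (P : pred I) (G : I -> K) :
  Vmonom z (\sum_(i <- r | P i) G i) = \sum_(i <- r | P i) Vmonom z (G i).
Proof. by apply: (big_morph (Vmonom z)) => [c1 c2|]; rewrite ?VmonomD ?Vmonom0. Qed.

Lemma Vmonom_inj z : injective (Vmonom z).
Proof. by move=> c1 c2 /(mulIf (expfz_neq0 z pi_neq0))/PhiC_inj. Qed.

Lemma VmonomZ z a c : lconst a *: Vmonom z c = Vmonom z (base_const a * c).
Proof. by rewrite /Vmonom !rmorphM base_constE -mulrA mulr_algl. Qed.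

Lemma base_constXz a (z : int) : base_const (a ^ z) = base_const a ^ z.
Proof.
by apply: PhiC_inj; rewrite base_constE -in_algE !fmorphXz /= base_constE.
Qed.

Lemma sigma_Vmonom z c : sigma (Vmonom z c) = Vmonom z (c ^+ q * u ^ z).
Proof.
rewrite /Vmonom rmorphM fmorphXz /= sigma_pi sigma_const expfzMl mulrA.
by rewrite !rmorphM !rmorphXn /= -fmorphXz /= -fmorphXz.
Qed.

(** The exponent for which sigma^i(pi) is u^([geom_sum i]) pi; for i = f the power of u is its norm
    from K to k. *)
Definition geom_sum i := (\sum_(l < i) q ^ l)%N.

Lemma geom_sumS i : geom_sum i.+1 = (geom_sum i * q + 1)%N.
Proof.
rewrite /geom_sum big_ord_recl addnC big_distrl; congr (_ + _)%N.
by apply: eq_bigr => l _; rewrite lift0 expnSr.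
Qed.

Lemma iter_sigma_Vmonom z c i :
  iter i sigma (Vmonom z c) = Vmonom z (c ^+ (q ^ i) * (u ^+ geom_sum i) ^ z).
Proof.
elim: i => [|i IH] /=; first by rewrite /geom_sum big_ord0 exp1rz expn0 mulr1.
rewrite IH sigma_Vmonom expnSr exprM geom_sumS exprD expr1 expfzMl exprMn exprM mulrA.
by rewrite !exprnP (exprzAC _ z).
Qed.

(** With S = [geom_sum f], the identity S q + 1 = S + q^f and u^(q^f) = u show that u^S is fixed by
    the q-th power map, so it comes from k. *)
Lemma norm_const_ex : exists zeta, base_const zeta = u ^+ geom_sum f.
Proof.
have uq : PhiC (u ^+ geom_sum f) ^+ q = PhiC (u ^+ geom_sum f).
  rewrite -!rmorphXn -exprM; congr (Phi (lconst _)); apply: (mulIf u_neq0).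
  rewrite -exprSr -addn1 -geom_sumS /geom_sum big_ord_recr /= exprD -card_K.
  by rewrite expf_card.
have [zeta zetaE] :=
  expf_card_image (in_alg L \o @lconst k) (etrans (congr1 _ card_k) uq).
by exists zeta; apply: PhiC_inj; rewrite [RHS]zetaE base_constE.
Qed.

Variable zeta : k.
Hypothesis zetaE : base_const zeta = u ^+ geom_sum f.

Lemma iter_f_sigma_Vmonom z c :
  iter f sigma (Vmonom z c) = lconst (zeta ^ z) *: Vmonom z c.
Proof.
by rewrite VmonomZ base_constXz zetaE mulrC iter_sigma_Vmonom -card_K expf_card.
Qed.

Lemma iter_fM_sigma_Vmonom z c m :
  iter (f * m) sigma (Vmonom z c) = lconst ((zeta ^ z) ^+ m) *: Vmonom z c.
Proof.
elim: m => [|m IH]; first by rewrite muln0 rmorph1 scale1r.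
rewrite mulnS iterD IH VmonomZ iter_f_sigma_Vmonom -VmonomZ scalerA -rmorphM.
by rewrite exprS.
Qed.

Lemma gal_expgE (n : nat) (y : L) : (sigma ^+ n)%g y = iter n sigma y.
Proof.
by elim: n => [|n IH]; rewrite ?expg0 ?gal_id // expgSr galM ?memvf // IH.
Qed.

Hypothesis order_sigma : #[sigma]%g = (e * f)%N.

(** sigma^(fm) fixes the constants and multiplies pi by zeta^m; so zeta^m = 1 exactly when
    sigma^(fm) is trivial, that is, when ef divides fm. *)
Lemma zeta_expr_eq1 m : (zeta ^+ m == 1) = (e %| m)%N.
Proof.
rewrite -(dvdn_pmul2r f_gt0) -order_sigma order_dvdn (mulnC m).
apply/eqP/eqP => [zm1|sm1].
  apply: gal_eq1 => [c|]; rewrite gal_expgE.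
    have := iter_fM_sigma_Vmonom 0 c m.
    by rewrite /Vmonom !expr0z !mulr1 expr1n rmorph1 scale1r.
  have := iter_fM_sigma_Vmonom 1 1 m.
  by rewrite /Vmonom !expr1z !rmorph1 !mul1r zm1 rmorph1 scale1r.
have := iter_fM_sigma_Vmonom 1 1 m; rewrite -gal_expgE sm1 gal_id VmonomZ.
move=> /Vmonom_inj; rewrite mulr1 -base_const1 => /base_const_inj.
by rewrite expr1z.
Qed.

Lemma zeta_prim : e.-primitive_root zeta.
Proof.
apply/andP; split=> //; apply/forallP => i; rewrite unity_rootE zeta_expr_eq1.
have := ltn_ord i; move: (nat_of_ord i) => {}i lti; rewrite eqn_leq lti /=.
apply/eqP; apply/idP/idP => [/dvdn_leq -> //|le].
by rewrite (@anti_leq e i.+1) ?dvdnn ?le.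
Qed.

Fact zeta_neq0 : zeta != 0.
Proof.
apply/eqP => z0; have /eqP := prim_expr_order zeta_prim.
by rewrite z0 expr0n gtn_eqF // eq_sym oner_eq0.
Qed.

(** * The minimal polynomial of sigma on V_z *)

Lemma poly_apply_Vmonom n (Q : {poly k}) z c : (size Q <= n)%N ->
  poly_apply (@lconst k) Q sigma (Vmonom z c) =
  Vmonom z (\sum_(i < n) base_const Q`_i * (u ^+ geom_sum i) ^ z * c ^+ (q ^ i)).
Proof.
move=> sQ; rewrite (poly_apply_widen _ _ _ sQ) Vmonom_sum; apply: eq_bigr => i _.
by rewrite iter_sigma_Vmonom VmonomZ -mulrA [X in _ * X]mulrC.
Qed.

Lemma q_gt1 : (1 < q)%N. Proof. by rewrite -card_k finNzRing_gt1. Qed.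

(* Q(sigma) acts on the coefficient c as a q-linearized polynomial of degree
   less than #|K|, which cannot vanish at all c unless it is zero. *)
Lemma poly_apply_eq0 (Q : {poly k}) z : (size Q <= f)%N ->
  (forall c, poly_apply (@lconst k) Q sigma (Vmonom z c) = 0) -> Q = 0.
Proof.
move=> sQ Qz; pose b i := base_const Q`_i * (u ^+ geom_sum i) ^ z.
pose P := \sum_(i < f) b i *: 'X^(q ^ i) : {poly K}.
have P0 : P = 0.
  apply/eqP/negPn/negP => /max_poly_roots/(_ (_ : all (root P) (enum K))).
  move=> /(_ _ (enum_uniq _)); rewrite -cardE card_K => H.
  suff : (q ^ f < size P)%N.
    apply/negP; rewrite -leqNgt; apply: leq_trans (size_sum _ _ _) _.
    apply/bigmax_leqP => i _; apply: leq_trans (size_scale_leq _ _) _.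
    by rewrite size_polyXn ltn_exp2l ?q_gt1.
  apply: H; apply/allP => c _; apply/rootP; apply: (@Vmonom_inj z).
  rewrite Vmonom0 -(Qz c) (poly_apply_Vmonom _ _ sQ) horner_sum.
  by congr Vmonom; apply: eq_bigr => i _; rewrite !hornerE.
apply/polyP => i; rewrite coef0; have [lti|gei] := ltnP i f; last first.
  by rewrite nth_default // (leq_trans sQ).
(* The exponents q^i are distinct, so the coefficient of X^(q^i) in [P] is [b i], a nonzero multiple
   of the image of the i-th coefficient of [Q]. *)
have := congr1 (fun R : {poly K} => R`_(q ^ i)) P0.
rewrite coef_sum coef0 (bigD1 (Ordinal lti)) //= big1 ?addr0 => [|l neq].
  rewrite coefZ coefXn eqxx mulr1 => /eqP; rewrite mulf_eq0.
  rewrite (negPf (expfz_neq0 _ (expf_neq0 _ u_neq0))) orbF -base_const0.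
  by move=> /eqP/base_const_inj.
rewrite coefZ coefXn eqn_exp2l ?q_gt1 // eq_sym.
by rewrite (negPf neq : (l == i :> nat) = false) mulr0.
Qed.

(** The candidate kills V_z because sigma^f acts there as zeta^z; the remainder of any other
    annihilating polynomial has degree below f, so it is 0 by [poly_apply_eq0]. *)
Lemma sigma_minpoly z :
  is_minpoly_on (@lconst k) (Vspace Phi z) sigma ('X^f - (zeta ^ z)%:P).
Proof.
set m := 'X^f - _.
have mz x : Vspace Phi z x -> poly_apply (@lconst k) m sigma x = 0.
  move=> [c ->]; rewrite -/(Vmonom z c) /m -polyCN poly_applyD poly_applyXn poly_applyC.
  by rewrite iter_f_sigma_Vmonom rmorphN scaleNr subrr.
split=> [|Q]; first exact: monicXnsubC.
split=> [QV|mQ x /mz]; last exact: poly_apply_dvd.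
apply/eqP/(@poly_apply_eq0 _ z).
  by rewrite -ltnS -(size_XnsubC (zeta ^ z) f_gt0) ltn_modp -size_poly_gt0 size_XnsubC.
move=> c; apply: (@addrI _ (poly_apply (@lconst k) (Q %/ m * m) sigma (Vmonom z c))).
rewrite -poly_applyD -divp_eq poly_applyM mz ?poly_apply0r ?addr0; last by exists c.
by apply: QV; exists c.
Qed.

(** * The V_z as modules over group algebras of H *)

Hypothesis sigma_gen : generator 'Gal({:L} / 1)%g sigma.

Lemma gal_expg_ex (g : gal_of {:L}) : exists n, g = (sigma ^+ n)%g.
Proof.
apply/cycleP; have := sigma_gen; rewrite /generator => /eqP <-.
(* Every element of [gal_of {:L}] fixes F, hence lies in the group generated by sigma. *)
by rewrite gal_kHom ?sub1v // k1HomE ahomWin.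
Qed.

Lemma sum_gal_group (M : nmodType) (G : gal_group L -> M) :
  \sum_g G g = \sum_(n < e * f) G (sigma ^+ n : gal_of {:L})%g.
Proof.
rewrite (reindex (fun n : 'I_(e * f) => (sigma ^+ n : gal_of {:L})%g)) //.
apply: onW_bij; apply: inj_card_bij => [i j /eqP|].
  rewrite eq_expg_mod_order order_sigma !modn_small // => /eqP; exact: val_inj.
rewrite card_ord -order_sigma; apply: (@leq_trans #|[set: gal_of {:L}]|).
  by rewrite cardsT.
apply: subset_leq_card.
apply/fintype.subsetP => g _; have [n ->] := gal_expg_ex g; exact: mem_cycle.
Qed.

Lemma Vspace_gal z (g : gal_of {:L}) x : Vspace Phi z x -> Vspace Phi z (g x).
Proof.
move=> [c ->]; have [n ->] := gal_expg_ex g.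
rewrite gal_expgE -/(Vmonom z c) iter_sigma_Vmonom.
by exists (c ^+ (q ^ n) * (u ^+ geom_sum n) ^ z).
Qed.

Lemma Vspace0 z : Vspace Phi z 0.
Proof. by exists 0; rewrite -/(Vmonom z 0) Vmonom0. Qed.

Lemma VspaceD z x y : Vspace Phi z x -> Vspace Phi z y -> Vspace Phi z (x + y).
Proof.
move=> [c1 ->] [c2 ->]; exists (c1 + c2).
by rewrite -!/(Vmonom z _) VmonomD.
Qed.

Lemma VspaceZ z a x : Vspace Phi z x -> Vspace Phi z (lconst a *: x).
Proof.
move=> [c1 ->]; exists (base_const a * c1).
by rewrite -!/(Vmonom z _) VmonomZ.
Qed.

(** The field [k0] is kept general to cover both F_q[H] and F_p[H]. *)
Lemma Vspace_submodule (k0 : fieldType) (h : {rmorphism k0 -> k}) z :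
  is_submodule (Vspace Phi z : set (gal_module L (@lconst k \o h))).
Proof.
split=> [|a x y Vx Vy]; first exact: Vspace0.
apply: VspaceD => //; rewrite gm_scaleE.
elim/big_ind: _ => [|x1 x2|g _]; [exact: Vspace0|exact: VspaceD|].
exact/VspaceZ/Vspace_gal.
Qed.

Lemma Vmonom_shift z c : Vmonom (z + e%:Z) c = lX k *: Vmonom z (c * w ^ s).
Proof.
rewrite -mulr_algl /Vmonom expfzDr ?pi_neq0 // -exprnP pi_e !rmorphM /=.
rewrite !fmorphXz /=.
by rewrite mulrCA mulrC !mulrA; congr (_ * _); rewrite mulrC !mulrA;
  congr (_ * _); rewrite mulrC.
Qed.

(** Division by t is H-equivariant, as t lies in F, and takes V_(z+e) to V_z because pi^e is w^s
    t. *)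
Lemma Vspace_isom_shift (z : int) :
  submodule_isom (Vspace Phi (z + e%:Z) : set (gal_module L (@lconst k)))
    (Vspace Phi z : set (gal_module L (@lconst k))).
Proof.
have sub z1 := Vspace_submodule idfun z1.
have X0 := lX_neq0 k.
split; [exact: sub|exact: sub|].
exists (fun x : L => (lX k)^-1 *: x); split; last first.
  move=> a x y _ _; rewrite scalerDr; congr (_ + _).
  rewrite !gm_scaleE scaler_sumr; apply: eq_bigr => g _.
  by rewrite /gg_app [g (_ *: _)]linearZ /= !scalerA mulrC.
split=> [_ [c ->]|x y _ _|_ [c ->]].
- rewrite -/(Vmonom _ c) Vmonom_shift scalerA mulVf // scale1r.
  by exists (c * w ^ s).
- exact/scalerI/invr_neq0.
exists (Vmonom (z + e%:Z) (c * w ^ (- s))); first by exists (c * w ^ (- s)).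
rewrite Vmonom_shift scalerA mulVf // scale1r -mulrA -expfzDr ?w_neq0 //.
by rewrite addNr expr0z mulr1.
Qed.

(** As zeta^e = 1, the polynomial divides X^(ef) - 1, which is separable when ef is nonzero in k. *)
Lemma XnsubC_separable (z : int) : (e * f)%:R != 0 :> k ->
  separable_poly ('X^f - (zeta ^ z)%:P).
Proof.
move=> /separable_Xn_sub_1; apply: dvdp_separable.
rewrite mulnC exprM (_ : 1 = (zeta ^ z)%:P ^+ e).
  by rewrite subrXX dvdp_mulIl.
rewrite -rmorphXn /= exprnP exprzAC -exprnP (prim_expr_order zeta_prim).
by rewrite exp1rz.
Qed.

Lemma Vspace_cyclic_vector (z : int) : (e * f)%:R != 0 :> k ->
  exists x, Vspace Phi z x /\
    is_annihilator (@lconst k) sigma x ('X^f - (zeta ^ z)%:P).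
Proof.
move=> ef0; rewrite -exists2E.
apply: cyclic_vector (XnsubC_separable z ef0) (sigma_minpoly z).
- exact: Vspace0.
- exact: VspaceD.
- move=> P _ [c ->]; rewrite -/(Vmonom z c) (poly_apply_Vmonom _ _ (leqnn _)).
  by eexists.
Qed.

(** * The isomorphism between the sum of e consecutive V_z and a free F_p[H]-module *)

Section GroupAlgebraIsom.
Variables (p : nat) (pchark : p \in [pchar k]) (z : int).
Local Notation kp := (pPrimeCharType pchark).
Local Notation r := (\dim {:kp}).
Local Notation A := (group_algebra 'F_p (gal_group L)).
Local Notation M := (gal_module L (@lconst k \o Fp_incl pchark)).
Local Notation W := (dsum (fun i : 'I_e => Vspace Phi (z + i%:Z) : set M)).
Variable x : 'I_e -> L.
Hypothesis xV : forall i : 'I_e, Vspace Phi (z + i%:Z) (x i).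
Hypothesis x_ann : forall i : 'I_e,
  is_annihilator (@lconst k) sigma (x i) ('X^f - (zeta ^ (z + i%:Z))%:P).

Let b (j : 'I_r) : k := (vbasis {:kp})`_j.

(** Since k[H] is the direct sum of the b_j F_p[H], this is the map k[H] -> W sending 1 to the
    family of cyclic vectors x_i, read over F_p. *)
Definition ga_map (a : {ffun 'I_r -> A^o}) : {ffun 'I_e -> M} :=
  [ffun i => \sum_j a j *: (lconst (b j) *: x i : M)].

Lemma ga_map_linear (a : A) x1 x2 :
  ga_map (a *: x1 + x2) = a *: ga_map x1 + ga_map x2.
Proof.
apply/ffunP => i; rewrite !ffunE scaler_sumr -big_split; apply: eq_bigr => j _.
by rewrite !ffunE scalerDl -scalerA.
Qed.

Lemma ga_map_dsum a : W (ga_map a).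
Proof.
move=> i; rewrite ffunE; elim/big_ind: _ => [|y1 y2|j _].
- exact: Vspace0.
- exact: VspaceD.
have [V0 VZ] := Vspace_submodule (Fp_incl pchark) (z + i%:Z).
by have := VZ (a j) _ 0 (VspaceZ (b j) (xV i)) V0; rewrite addr0.
Qed.

(** H consists of the sigma^n with n < ef, so an element of k[H] acts as a polynomial in sigma of
    degree below ef, the same one for every i. *)
Lemma ga_mapE a i : ga_map a i = poly_apply (@lconst k)
  (\poly_(n < e * f) \sum_j Fp_incl pchark (a j (sigma ^+ n : gal_of {:L})%g) * b j)
  sigma (x i).
Proof.
rewrite (poly_apply_widen _ _ _ (size_poly _ _)) ffunE.
under eq_bigr do rewrite gm_scaleE sum_gal_group.
rewrite exchange_big; apply: eq_bigr => n _.
rewrite coef_poly ltn_ord rmorph_sum scaler_suml; apply: eq_bigr => j _.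
set g := (sigma ^+ n)%g.
have gZ : gg_app g (lconst (b j) *: x i) = lconst (b j) *: g (x i) by exact: linearZ.
apply: (etrans (congr1 (fun y : L => lconst (Fp_incl pchark (a j g)) *: y) gZ)).
by rewrite scalerA -rmorphM gal_expgE.
Qed.

(** The zeta^(z+i) for i < e are distinct because zeta is primitive, so the divisors are pairwise
    coprime and their product has degree ef. *)
Lemma XnsubC_dvd_eq0 (Q : {poly k}) :
  (forall i : 'I_e, 'X^f - (zeta ^ (z + i%:Z))%:P %| Q) -> (size Q <= e * f)%N -> Q = 0.
Proof.
move=> dvdQ sQ; apply/eqP/negPn/negP => Q0; move: sQ; apply/negP; rewrite -ltnNge.
have cop (i j : 'I_e) : i != j -> coprimep ('X^f - (zeta ^ (z + i%:Z))%:P)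
    ('X^f - (zeta ^ (z + j%:Z))%:P).
  move=> ij; apply: coprimep_subC; apply: contra ij => /eqP.
  rewrite !expfzDr ?zeta_neq0 // => /(mulfI (expfz_neq0 z zeta_neq0))/eqP.
  by rewrite -!exprnP (eq_prim_root_expr zeta_prim) !modn_small.
apply: leq_trans (dvdp_leq Q0 (dvdp_prod_coprime cop dvdQ)).
rewrite size_prod => [|i _]; last by rewrite -size_poly_gt0 size_XnsubC.
under eq_bigr do rewrite size_XnsubC //.
by rewrite sum_nat_const card_ord mulnS addnC -addSn addnK.
Qed.

(** The polynomial attached to [a] kills every x_i, hence is 0; its coefficients are
    F_p-combinations of the basis b, so all coordinates of [a] vanish. *)
Lemma ga_map_eq0 a : ga_map a = 0 -> a = 0.
Proof.
move=> a0; set Q := \poly_(n < e * f)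
  \sum_j Fp_incl pchark (a j (sigma ^+ n : gal_of {:L})%g) * b j.
have Q0 : Q = 0.
  apply: XnsubC_dvd_eq0 (size_poly _ _) => i; apply/x_ann.
  by rewrite -ga_mapE a0 ffunE.
apply/ffunP => j; apply/ffunP => g; rewrite !ffunE.
have [n ->] := gal_expg_ex g; rewrite -expg_mod_order order_sigma.
have ltn : (n %% (e * f) < e * f)%N by rewrite ltn_mod muln_gt0 e_gt0.
have /(congr1 (fun P : {poly k} => P`_(n %% (e * f)))) := Q0.
rewrite coef0 coef_poly ltn => sum0.
set g1 := (sigma ^+ _)%g in sum0 *.
have /freeP/(_ (fun i => a i g1)) free_b := basis_free (vbasisP {:kp}).
apply: free_b; rewrite -[RHS]sum0; apply: eq_bigr => i _.
exact/esym/Fp_inclM.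
Qed.

Lemma ga_map_inj : injective ga_map.
Proof.
move=> a1 a2 eqa; apply/eqP; rewrite -subr_eq0; apply/eqP/ga_map_eq0.
by rewrite addrC -scaleN1r ga_map_linear eqa scaleN1r addNr.
Qed.

(** Elements of W are encoded by their e coefficients in the finite field K. Both sides then have
    p^(r e f) elements, so the injection is onto. *)
Lemma ga_map_surj y : W y -> exists a, ga_map a = y.
Proof.
have lift (y1 : {ffun 'I_e -> M}) : W y1 ->
    exists c : {ffun 'I_e -> K}, y1 = [ffun i : 'I_e => Vmonom (z + i%:Z) (c i)].
  move=> Wy; have [c cP] := choice Wy; exists [ffun i => c i].
  by apply/ffunP => i; rewrite !ffunE [LHS]cP.
have [c cP] := choice (fun a => lift _ (ga_map_dsum a)).
have c_inj : injective c by move=> a1 a2 eqc; apply: ga_map_inj; rewrite !cP eqc.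
have card_le : (#|{ffun 'I_e -> K}| <= #|{ffun 'I_r -> {ffun gal_group L -> 'F_p}}|)%N.
  have p_prime := pcharf_prime pchark.
  have card_gal : #|gal_group L| = (e * f)%N.
    by rewrite -sum1_card sum_gal_group sum1_card card_ord.
  have card_kp : #|k| = (p ^ r)%N.
    by rewrite pprimeChar_dimf -card_pprimeChar.
  rewrite !card_ffun card_Fp // !card_ord card_K -card_k card_kp card_gal.
  by rewrite -!expnM; apply/eq_leq; congr (_ ^ _)%N; lia.
have [c' _ cK] := inj_card_bij c_inj card_le.
by move=> /lift[d ->]; exists (c' d); rewrite cP cK.
Qed.

Lemma dsum_isom : submodule_isom W (@setT {ffun 'I_r -> A^o}).
Proof.
apply: (@submodule_isom_inv _ _ _ _ _ ga_map).
- split=> [i|a x1 x2 Wx1 Wx2 i]; rewrite !ffunE; first exact: Vspace0.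
  exact: (Vspace_submodule (Fp_incl pchark) (z + i%:Z)).2 a _ _ (Wx1 i) (Wx2 i).
- by [].
- exact: ga_map_linear.
- split=> [a _|a1 a2 _ _|y /ga_map_surj[a <-]]; [exact: ga_map_dsum|exact: ga_map_inj|].
  by exists a.
Qed.
End GroupAlgebraIsom.
End LocalGalois.

Theorem theorem3p1
    (p r q e f d : nat) (k K : finFieldType) (pchark : p \in [pchar k])
    (L : splittingFieldType (laurent k)) (Phi : {rmorphism laurent K -> L})
    (omega : {unit K}) (s : int) (sigma : gal_of {:L})
    (p_prime : prime p) (q_pow : q = (p ^ r)%N) (card_k : #|k| = q)
    (galois_L : galois 1 {:L}) (cyclic_L : cyclic 'Gal({:L} / 1))
    (degree_L : \dim {:L} = d) (d_ef : d = (e * f)%N) (p_ndvd_d : ~~ (p %| d)%N)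
    (card_K : #|K| = (q ^ f)%N) (Phi_bij : bijective Phi)
    (ram_e : is_ramification_index Phi e)
    (omega_gen : generator [set: {unit K}]%g omega)
    (pi_e : Phi (lX K) ^+ e = Phi (lconst (val omega)) ^ s * (lX k)%:A)
    (sigma_gen : generator 'Gal({:L} / 1) sigma)
    (sigma_const : forall c : K, sigma (Phi (lconst c)) = Phi (lconst c) ^+ q)
    (sigma_pi : exists2 c : K, c != 0 & sigma (Phi (lX K)) = Phi (lconst c) * Phi (lX K)) :
  let Fq_module := gal_module L (@lconst k) in
  let Fp_module := gal_module L (@lconst k \o Fp_incl pchark) in
  let V := Vspace Phi in
  [/\ exists zeta : k, e.-primitive_root zeta /\
        forall z : int,
          is_minpoly_on (@lconst k) (V z) sigma ('X^f - (zeta ^ z)%:P),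
      forall z : int,
        submodule_isom (V (z + e%:Z) : set Fq_module) (V z : set Fq_module)
    & forall z : int,
        submodule_isom (dsum (fun i : 'I_e => V (z + i%:Z) : set Fp_module))
          (@setT {ffun 'I_(\dim {: pPrimeCharType pchark}) ->
                   (group_algebra 'F_p (gal_group L))^o})].
Proof.
(* d is nonzero because p divides 0. *)
have d_gt0 : (0 < e * f)%N by rewrite lt0n -d_ef; apply: contraNneq p_ndvd_d => ->.
have [e_gt0 f_gt0] : (0 < e)%N /\ (0 < f)%N by apply/andP; rewrite -muln_gt0.
have [u u_neq0 sigma_u] := sigma_pi.
have order_sigma : #[sigma]%g = (e * f)%N.
  rewrite /order; have := sigma_gen; rewrite /generator => /eqP <-.
  by rewrite -(galois_dim galois_L) dimv1 divn1 degree_L.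
have ef_neq0 : (e * f)%:R != 0 :> k by rewrite -(dvdn_pcharf pchark) -d_ef.
have [zeta zetaE] := norm_const_ex Phi card_k card_K u_neq0.
have cyc z := Vspace_cyclic_vector e_gt0 f_gt0 Phi_bij ram_e pi_e u_neq0 sigma_u
  sigma_const zetaE order_sigma z ef_neq0.
split=> [|z|z].
- exists zeta; split=> [|z].
    exact: (zeta_prim e_gt0 f_gt0 Phi_bij ram_e pi_e sigma_u sigma_const zetaE
      order_sigma).
  exact: (sigma_minpoly f_gt0 u_neq0 sigma_u sigma_const zetaE).
- exact: (Vspace_isom_shift card_k card_K pi_e sigma_u sigma_const sigma_gen).
(* One cyclic vector is chosen in each of the e consecutive spaces. *)
have [x xP] := choice (fun i : 'I_e => cyc (z + i%:Z)).
exact: (dsum_isom e_gt0 f_gt0 Phi_bij ram_e pi_e u_neq0 sigma_u sigma_const zetaE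
  order_sigma sigma_gen pchark (fun i => (xP i).1) (fun i => (xP i).2)).
Qed.
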